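(* Let $(I,J,U)$ be a two-player repeated game with vector payoffs in $\mathbb{R}^n$. Let $A$ be a subset of $\mathbb{R}^n$ and let $D$ be an open and convex subset of $\mathbb{R}^n$. Then the set $A$ is approachable by Player 1 while remaining in $D$ if and only if both of the following conditions hold: (C1) the set $\overline{A}\cap\overline{D}$ is approachable by Player 1; (C2) there exists an action $s\in I$ such that $U(s,j)\in D$ for every action $j\in J$.
   Context: A two-player repeated game with vector payoffs is a triplet $(I,J,U)$, where $I,J$ are finite action sets of Players 1 and 2 with $|I|\ge 2$, $|J|\ge 2$, and $U: I\times J\to\mathbb{R}^n$ satisfies $0\le U_k(i,j)\le 1$ for all $i\in I$, $j\in J$, $1\le k\le n$. At every stage $t\ge 1$ the players independently and simultaneously choose $(i_t,j_t)\in I\times J$, which is observed by both. $H=\bigcup_{t\ge 0}(I\times J)^t$ is the set of finite histories. A (behavior) strategy of Player 1 is a function $\sigma:H\to\Delta(I)$, and of Player 2 a function $\tau:H\to\Delta(J)$, where $\Delta(X)$ is the set of probability distributions over $X$; $\mathcal{S}$ and $\mathcal{T}$ are the sets of strategies of Players 1 and 2. A pair $(\sigma,\tau)$ induces a probability distribution $P_{\sigma,\tau}$ on the set $(I\times J)^\infty$ of infinite plays (with the sigma-algebra generated by finite cylinders). The average payoff up to stage $t\ge 1$ is $g_t=\frac1t\sum_{k=1}^t U(i_k,j_k)$. $d$ denotes Euclidean distance, and $\overline{X}$ denotes the closure of $X$. A set $A\subseteq\mathbb{R}^n$ is approachable by Player 1 if there exists $\sigma\in\mathcal{S}$ such that for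 every $\epsilon>0$ there is an integer $T$ such that for every $\tau\in\mathcal{T}$, $P_{\sigma,\tau}[d(g_t,A)<\epsilon,\ \forall t\ge T]>1-\epsilon$. For $A,D\subseteq\mathbb{R}^n$, the set $A$ is approachable by Player 1 while remaining in $D$ if there exists $\sigma\in\mathcal{S}$ such that for every $\epsilon>0$ there is an integer $T$ such that for every $\tau\in\mathcal{T}$ both $P_{\sigma,\tau}[\forall t\ge T,\ d(g_t,A)<\epsilon]>1-\epsilon$ and $P_{\sigma,\tau}[\forall t\ge 1,\ g_t\in D]=1$. The distance to the empty set is $+\infty$. *)

(* Defs.v *)
From HB Require Import structures.
From mathcomp Require Import all_boot all_order all_algebra.
From mathcomp Require Import all_classical all_reals all_analysis.

Set Implicit Arguments.
Unset Strict Implicit.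
Unset Printing Implicit Defensive.

Import Order.TTheory GRing.Theory Num.Theory.
Import numFieldNormedType.Exports.

Local Open Scope classical_set_scope.
Local Open Scope ring_scope.

(* The topology that MathComp-Analysis puts on 'rV[R]_n (used by [open] and
   [closure]) is the product topology, i.e. the one induced by [eucl_dist]. *)
Section euclidean_distance.
Variables (R : realType) (n : nat).

Definition eucl_dist (x y : 'rV[R]_n) : R :=
  Num.sqrt (\sum_(k < n) (x ord0 k - y ord0 k) ^+ 2).

(* [ereal_inf set0 = +oo]: the distance to the empty set is infinite. *)
Definition eucl_dist_set (x : 'rV[R]_n) (A : set 'rV[R]_n) : \bar R :=
  ereal_inf [set (eucl_dist x a)%:E | a in A].

End euclidean_distance.

Record fdist (R : realType) (X : finType) := FDist {
  fdist_fun :> X -> R;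
  fdist_ge0 : forall x, 0 <= fdist_fun x;
  fdist_sum1 : \sum_(x : X) fdist_fun x = 1 }.

Record game (R : realType) (n : nat) := Game {
  act1 : finType;
  act2 : finType;
  payoff : act1 -> act2 -> 'rV[R]_n;
  card_act1 : (2 <= #|act1|)%N;
  card_act2 : (2 <= #|act2|)%N;
  payoff01 : forall i j (k : 'I_n), 0 <= payoff i j ord0 k <= 1 }.

Section play.
Variables (R : realType) (n : nat) (G : game R n).

(* Histories are listed in chronological order. *)
Definition history := seq (act1 G * act2 G).

Definition strategy1 := history -> fdist R (act1 G).
Definition strategy2 := history -> fdist R (act2 G).

(* Stages of a play are numbered from 0: [w t] is the pair of actions
   (i_{t+1}, j_{t+1}), and [mkseq w t] is the history of the first t stages. *)
Definition play := nat -> act1 G * act2 G.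

HB.instance Definition _ := Choice.on play.

(* The measurable types of the library are pointed. *)
Definition play0 : play := fun=>
  (enum_val (Ordinal (ltnW (card_act1 G))),
   enum_val (Ordinal (ltnW (card_act2 G)))).

HB.instance Definition _ := isPointed.Build play play0.

Definition cylinder (w : play) (t : nat) : set play :=
  [set w' | mkseq w' t = mkseq w t].

Definition cylinders : set (set play) :=
  [set C | exists w t, C = cylinder w t].

(* The plays with the sigma-algebra generated by the finite cylinders. *)
Definition playM := g_sigma_algebraType cylinders.

Definition is_play_law (sigma : strategy1) (tau : strategy2)
    (P : probability playM R) : Prop :=
  forall (w : play) (t : nat),
    P (cylinder w t) =
    (\prod_(s < t) (sigma (mkseq w s) (w s).1 * tau (mkseq w s) (w s).2))%:E.

End play.

(* Existence of the law: split [0, 1[ into nested intervals indexed by the histories, the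
   length of each being the probability of the history. *)
Section play_law_existence.
Variables (R : realType) (n : nat) (G : game R n).
Variables (sigma : strategy1 G) (tau : strategy2 G).
Implicit Types (h : history G) (w : play G) (k : act1 G * act2 G) (u : R).

Let K : finType := (act1 G * act2 G)%type.
Let e : seq K := enum K.

Let q h k : R := sigma h k.1 * tau h k.2.

Let q_ge0 h k : 0 <= q h k.
Proof. by rewrite mulr_ge0// fdist_ge0. Qed.

Let q_sum1 h : \sum_(k : K) q h k = 1.
Proof.
rewrite -(pair_bigA _ (fun i j => sigma h i * tau h j))/=.
under eq_bigr do rewrite -mulr_sumr fdist_sum1 mulr1.
exact: fdist_sum1.
Qed.

Let C h (m : nat) : R := \sum_(k <- take m e) q h k.

Let C0 h : C h 0 = 0.
Proof. by rewrite /C take0 big_nil. Qed.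

Let C1 h : C h (size e) = 1.
Proof. by rewrite /C take_size /e big_enum/= q_sum1. Qed.

Let CS h k : C h (index k e).+1 = C h (index k e) + q h k.
Proof.
have ke : (index k e < size e)%N by rewrite index_mem mem_enum.
by rewrite /C (take_nth k)// nth_index ?mem_enum// big_rcons/= addrC.
Qed.

Let C_homo h (m m' : nat) : (m <= m')%N -> C h m <= C h m'.
Proof.
move=> mm'; rewrite /C -(subnKC mm') takeD big_cat/= lerDl.
by rewrite sumr_ge0.
Qed.

Let c h k := C h (index k e).

Let c_ge0 h k : 0 <= c h k.
Proof. by rewrite /c -(C0 h) C_homo. Qed.

Let cq_le1 h k : c h k + q h k <= 1.
Proof. by rewrite /c -CS -(C1 h) C_homo// index_mem mem_enum. Qed.

Let c_cover h v : 0 <= v < 1 -> exists k, c h k <= v < c h k + q h k.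
Proof.
move=> /andP[v0 v1].
have ex : exists m, v < C h m by exists (size e); rewrite C1.
case: (ex_minnP ex) => -[|m] vm mmin.
  by move: vm; rewrite C0 ltNge v0.
have Cmv : C h m <= v.
  by rewrite leNgt; apply/negP => /mmin; rewrite ltnn.
have me : (m < size e)%N.
  rewrite ltnNge; apply/negP => /(C_homo h); rewrite C1 => /(lt_le_trans v1).
  by rewrite ltNge Cmv.
pose k := nth (play0 G 0) e m.
have km : index k e = m by rewrite index_uniq// enum_uniq.
by exists k; rewrite -CS /c km Cmv.
Qed.

Let c_disj h k k' v : c h k <= v < c h k + q h k ->
  c h k' <= v < c h k' + q h k' -> k = k'.
Proof.
rewrite -!CS /c => /andP[kv vk] /andP[k'v vk'].
have [kk'|kk'|kk'] := ltngtP (index k e) (index k' e).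
- by have := lt_le_trans vk (C_homo h kk'); rewrite ltNge k'v.
- by have := lt_le_trans vk' (C_homo h kk'); rewrite ltNge kv.
- by have := congr1 (nth k e) kk'; rewrite !nth_index ?mem_enum.
Qed.

Let p w t := \prod_(s < t) q (mkseq w s) (w s).
Let a w t := \sum_(s < t) p w s * c (mkseq w s) (w s).

Let pS w t : p w t.+1 = p w t * q (mkseq w t) (w t).
Proof. by rewrite /p big_ord_recr. Qed.

Let aS w t : a w t.+1 = a w t + p w t * c (mkseq w t) (w t).
Proof. by rewrite /a big_ord_recr. Qed.

Let p_ge0 w t : 0 <= p w t.
Proof. by rewrite /p prodr_ge0. Qed.

Let Jin w t u := a w t <= u < a w t + p w t.

Let Jin0 w u : Jin w 0 u = (0 <= u < 1).
Proof. by rewrite /Jin /a /p !big_ord0 add0r. Qed.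

Let JinW w t u : Jin w t.+1 u -> Jin w t u.
Proof.
rewrite /Jin aS pS -addrA -mulrDr => /andP[l r]; apply/andP; split.
  by apply: le_trans l; rewrite lerDl mulr_ge0.
by apply: (lt_le_trans r); rewrite lerD2l ler_piMr.
Qed.

Let Jin01 w t u : Jin w t u -> 0 <= u < 1.
Proof. by elim: t => [|t IH /JinW//]; rewrite Jin0. Qed.

Let Jin_p_gt0 w t u : Jin w t u -> 0 < p w t.
Proof. by move=> /andP[l r]; have := le_lt_trans l r; rewrite ltrDl. Qed.

Let JinS w t u : 0 < p w t -> Jin w t.+1 u =
  (c (mkseq w t) (w t) <= (u - a w t) / p w t
    < c (mkseq w t) (w t) + q (mkseq w t) (w t)).
Proof.
move=> p0; rewrite /Jin aS pS -addrA -mulrDr.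
by rewrite ler_pdivlMr// ltr_pdivrMr// lerBrDl ltrBlDl 2!(mulrC (p w t)).
Qed.

Let eq_mkseqP w w' t : mkseq w t = mkseq w' t <->
  forall s, (s < t)%N -> w s = w' s.
Proof.
split=> [/eq_in_map ww' s st|ww'].
  by apply: ww'; rewrite mem_iota.
by apply/eq_in_map => s; rewrite mem_iota => /ww'.
Qed.

Let eq_mkseqW w w' t s : (s <= t)%N -> mkseq w t = mkseq w' t ->
  mkseq w s = mkseq w' s.
Proof.
move=> st /eq_mkseqP ww'; apply/eq_mkseqP => r rs; apply: ww'.
exact: leq_trans st.
Qed.

Let eq_p w w' t : mkseq w t = mkseq w' t -> p w t = p w' t.
Proof.
move=> ww'; apply: eq_bigr => s _.
rewrite (eq_mkseqW (ltnW (ltn_ord s)) ww').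
by move/eq_mkseqP : ww' => ->.
Qed.

Let eq_a w w' t : mkseq w t = mkseq w' t -> a w t = a w' t.
Proof.
move=> ww'; apply: eq_bigr => s _.
rewrite (eq_p (eq_mkseqW (ltnW (ltn_ord s)) ww')).
rewrite (eq_mkseqW (ltnW (ltn_ord s)) ww').
by move/eq_mkseqP : ww' => ->.
Qed.

Let eq_Jin w w' t u : mkseq w t = mkseq w' t -> Jin w t u = Jin w' t u.
Proof. by move=> ww'; rewrite /Jin (eq_a ww') (eq_p ww'). Qed.

Let Jin_inj w w' t u : Jin w t u -> Jin w' t u -> mkseq w t = mkseq w' t.
Proof.
elim: t => [//|t IH Jw Jw'].
have ww' := IH (JinW Jw) (JinW Jw').
have p0 := Jin_p_gt0 (JinW Jw); have p0' := Jin_p_gt0 (JinW Jw').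
move: Jw Jw'; rewrite !JinS// -(eq_a ww') -(eq_p ww') -ww' => Jw Jw'.
by rewrite !mkseqS ww' (c_disj Jw Jw').
Qed.

Let Jin_next w t u : Jin w t u ->
  exists w', mkseq w' t = mkseq w t /\ Jin w' t.+1 u.
Proof.
move=> Jw; have p0 := Jin_p_gt0 Jw.
have [|k hk] := @c_cover (mkseq w t) ((u - a w t) / p w t).
  move: Jw => /andP[l r].
  by rewrite divr_ge0 ?subr_ge0//= ltr_pdivrMr// mul1r ltrBlDl.
pose w' : play G := fun s => if s == t then k else w s.
have ww' : mkseq w' t = mkseq w t.
  by apply/eq_mkseqP => s st; rewrite /w' lt_eqF.
exists w'; split => //.
by rewrite JinS (eq_p ww')// (eq_a ww') ww' /w' eqxx.
Qed.

Let Jin_exists u : 0 <= u < 1 -> exists w, forall t, Jin w t u.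
Proof.
move=> u01.
have W0 : {w | Jin w 0 u} by exists (play0 G); rewrite Jin0.
pose f t (x : {w | Jin w t u}) := cid (Jin_next (svalP x)).
pose W := fix W t : {w | Jin w t u} := match t with
  | 0 => W0
  | s.+1 => exist _ (sval (f s (W s))) (svalP (f s (W s))).2
  end.
have WS t : mkseq (sval (W t.+1)) t = mkseq (sval (W t)) t.
  exact: (svalP (f t (W t))).1.
exists (fun t => sval (W t.+1) t) => t.
rewrite (@eq_Jin _ (sval (W t))); first exact: (svalP (W t)).
elim: t => [//|t IH]; rewrite !mkseqS; congr rcons.
by rewrite IH -WS.
Qed.

Let X_ex u : exists w, forall t, 0 <= u < 1 -> Jin w t u.
Proof.
have [/Jin_exists[w Jw]|_] := boolP (0 <= u < 1); first by exists w.
by exists (play0 G).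
Qed.

Let Y u := sval (cid (X_ex u)).

(* Outside [0, 1[ the value does not matter, as long as X is measurable. *)
Let X u : playM G := Y (if 0 <= u < 1 then u else 0).

Let X_in u t : 0 <= u < 1 -> Jin (X u) t u.
Proof. by move=> u01; rewrite /X u01; exact: (svalP (cid (X_ex u))). Qed.

Let X_out u : ~~ (0 <= u < 1) -> X u = X 0.
Proof. by move=> /negbTE u01; rewrite /X u01 if_same. Qed.

Let J w t : set R := `[a w t, a w t + p w t[%classic.

Let X_cylinder w t : `[0%R, 1%R[ `&` X @^-1` (cylinder w t) = J w t.
Proof.
apply/seteqP; split=> u; rewrite /J /= !in_itv/=.
  by move=> [u01 Xw]; have := X_in t u01; rewrite (eq_Jin _ Xw).
move=> Ju; have {}Ju : Jin w t u by [].
by have u01 := Jin01 Ju; split=> //; exact: Jin_inj (X_in _ u01) Ju.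
Qed.

Let measurable_X : measurable_fun [set: measurableTypeR R] X.
Proof.
apply: (@measurability _ _ _ (playM G) _ X (@cylinders _ _ G)) => //.
move=> _ [_ [w [t ->]] <-]; rewrite setTI.
rewrite -(setIT (X @^-1` _)) -(setvU `[0%R, 1%R[) setIUr; apply: measurableU.
  have [X0|X0] := pselect (cylinder w t (X 0)).
    rewrite (_ : _ `&` _ = ~` `[0%R, 1%R[); first exact: measurableC.
    apply/seteqP; split=> u /=; first by case.
    by move=> u01; split=> //; rewrite X_out//; move: u01; rewrite in_itv => /negP.
  rewrite (_ : _ `&` _ = set0)//.
  apply/seteqP; split=> u //= [] /[swap]; rewrite in_itv/= => /negP /X_out ->.
  exact.
by rewrite setIC X_cylinder; exact: measurable_itv.
Qed.

Lemma play_law_exists : exists P, is_play_law sigma tau P.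
Proof.
pose mu := mrestr (@lebesgue_measure R) (measurable_itv `[0%R, 1%R[).
have mu1 : mu setT = 1%E.
  by rewrite /mu /mrestr setTI lebesgue_measure_itv/= lte01 sube0.
pose P1 : probability (measurableTypeR R) R :=
  HB.pack mu (Measure_isProbability.Build _ _ _ mu mu1).
pose X' : {mfun measurableTypeR R >-> playM G} :=
  HB.pack X (isMeasurableFun.Build _ _ _ _ _ measurable_X).
exists (distribution P1 X') => w t.
rewrite /distribution/= /pushforward/= /mu /mrestr setIC X_cylinder.
rewrite lebesgue_measure_itv/= lte_fin ltrDl.
case: ifPn => [_|]; first by rewrite EFinD addeAC -EFinB subrr add0e.
rewrite -leNgt => pw0; congr (_%:E).
by apply/eqP; rewrite eq_le p_ge0.
Qed.

End play_law_existence.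

Section play_law.
Variables (R : realType) (n : nat) (G : game R n).
Variables (sigma : strategy1 G) (tau : strategy2 G).

Lemma play_law_unique (P Q : probability (playM G) R) :
  is_play_law sigma tau P -> is_play_law sigma tau Q ->
  forall A : set (playM G), measurable A -> P A = Q A.
Proof.
move=> lP lQ A mA; pose H := [set C | C = set0 \/ @cylinders _ _ G C].
have HM : H `<=` @measurable _ (playM G).
  by move=> C [->|GC]; [exact: measurable0|exact: sub_sigma_algebra].
apply: (@g_sigma_algebra_measure_unique _ R (playM G) H HM (fun=> setT) _ _ P Q).
- by move=> _; right; exists (play0 G), 0%N; apply/seteqP.
- by rewrite bigcup_const//; exists 0%N.
- move=> B B' [->|[w [t ->]]]; first by rewrite set0I; left.
  move=> [->|[w' [t' ->]]]; first by left; rewrite setI0.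
  wlog tt' : w w' t t' / (t <= t')%N.
    move=> wl; have [|/ltnW] := leqP t t'; first exact: wl.
    by rewrite setIC; exact: wl.
  have takeW (v v' : play G) : mkseq v t' = mkseq v' t' ->
      mkseq v t = mkseq v' t.
    by move=> /(congr1 (take t)); rewrite -!map_take !take_iota (minn_idPl tt').
  have [ww'|ww'] := pselect (mkseq w' t = mkseq w t).
    right; exists w', t'; apply/seteqP; split=> [v []//|v /= vw'].
    by split=> //; rewrite /cylinder/= (takeW _ _ vw').
  left; apply/seteqP; split=> // v [/= vw vw'].
  by apply: ww'; rewrite -(takeW _ _ vw').
- move=> B [->|[w [t ->]]]; first by rewrite !measure0.
  exact: etrans (lP w t) (esym (lQ w t)).
- by move=> _; apply: (le_lt_trans (probability_le1 P measurableT)); exact: ltry.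
- by apply: sub_sigma_algebra2 mA => C; right.
Qed.

Definition play_law : probability (playM G) R :=
  sval (cid (play_law_exists sigma tau)).

Lemma play_lawP : is_play_law sigma tau play_law.
Proof. exact: svalP. Qed.

End play_law.

Section approachability.
Variables (R : realType) (n : nat) (G : game R n).

(* Average payoff over the first t stages; only meaningful for t > 0. *)
Definition avg_payoff (t : nat) (w : play G) : 'rV[R]_n :=
  t%:R^-1 *: \sum_(s < t) payoff (w s).1 (w s).2.

Definition eventually_near (A : set 'rV[R]_n) (e : R) (T : nat) :
    set (playM G) :=
  [set w | forall t, (1 <= t)%N -> (T <= t)%N ->
    (eucl_dist_set (avg_payoff t w) A < e%:E)%E].

Definition always_in (D : set 'rV[R]_n) : set (playM G) :=
  [set w | forall t, (1 <= t)%N -> D (avg_payoff t w)].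

Definition approachable (A : set 'rV[R]_n) : Prop :=
  exists sigma : strategy1 G, forall e : R, 0 < e ->
    exists T : nat, forall tau : strategy2 G,
      ((1 - e)%:E < play_law sigma tau (eventually_near A e T))%E.

Definition approachable_remaining_in (A D : set 'rV[R]_n) : Prop :=
  exists sigma : strategy1 G, forall e : R, 0 < e ->
    exists T : nat, forall tau : strategy2 G,
      ((1 - e)%:E < play_law sigma tau (eventually_near A e T))%E /\
      play_law sigma tau (always_in D) = 1%E.

End approachability.

(* Main.v *)
Require Import Defs.
From HB Require Import structures.
From mathcomp Require Import all_boot all_order all_algebra.
From mathcomp Require Import all_classical all_reals all_analysis.
From mathcomp Require Import lra ring.

Set Implicit Arguments.
Unset Strict Implicit.
Unset Printing Implicit Defensive.

Import Order.TTheory GRing.Theory Num.Theory.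
Import numFieldNormedType.Exports.

Local Open Scope classical_set_scope.
Local Open Scope ring_scope.

(* Necessity: the plays almost surely stay in D, the means lie in a fixed compact
   set, and there being close to both A and D forces closeness to
   [closure A `&` closure D]; the support of the first move provides s.

   Sufficiency: let sigma approach B = [closure A `&` closure D]. A stage is safe if
   whatever is played there the mean stays in D; at safe stages follow sigma, fed
   with the sub-history of the safe stages, and otherwise play s, which keeps the
   mean in D by convexity. A ball of radius r around each U(s, j) lies in D. If the
   sub-history has N stages and mean b + O(e) with b in B, and s has been played at
   the M other stages, the next mean is within (N e + O(1)) / (N + M + 1) of the
   convex combination (N b + M c) / (N + M) where c is surrounded by a ball of radius r
   in D; so an unsafe stage can only occur while M r <= N e + O(1). Hence the
   fraction of unsafe stages is eventually O(e), and the mean is close to B.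
   The law of the sub-history is controlled without constructing a conditional
   strategy of Player 2: on a finite horizon, the value of the game "violate the
   approachability estimate of sigma" is a submartingale along the sub-history. *)

(** * Sup-norm neighbourhoods and the Euclidean distance *)

Section euclidean_neighbourhoods.
Variables (R : realType) (n : nat).
Implicit Types (x y a : 'rV[R]_n) (A : set 'rV[R]_n) (e : R).

Lemma coord_le_norm x k : `|x ord0 k| <= `|x|.
Proof.
rewrite [leRHS]mx_normrE.
exact: (le_bigmax _ (fun ij : 'I_1 * 'I_n => `|x ij.1 ij.2|) (ord0, k)).
Qed.

Lemma norm_rV_le x e : 0 <= e -> (forall k, `|x ord0 k| <= e) -> `|x| <= e.
Proof.
move=> e0 xe; rewrite [leLHS]mx_normrE; apply/bigmax_leP; split => // -[i j] _ /=.
by rewrite ord1.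
Qed.

Lemma norm_le_eucl_dist x y : `|x - y| <= eucl_dist x y.
Proof.
apply: norm_rV_le => [|k]; first exact: sqrtr_ge0.
rewrite -sqrtr_sqr; apply: ler_wsqrtr; rewrite !mxE (bigD1 k)//= lerDl.
by apply: sumr_ge0 => i _; exact: sqr_ge0.
Qed.

Lemma eucl_dist_le_norm x y : eucl_dist x y <= Num.sqrt n%:R * `|x - y|.
Proof.
rewrite -[X in _ * X]ger0_norm// -sqrtr_sqr -sqrtrM ?ler0n//.
apply: ler_wsqrtr.
rewrite (_ : _ * _ = \sum_(k < n) `|x - y| ^+ 2); last first.
  by rewrite sumr_const card_ord mulr_natl.
apply: ler_sum => k _; rewrite -real_normK ?num_real//.
have := coord_le_norm (x - y) k; rewrite !mxE => xyk.
by rewrite lerXn2r// nnegrE.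
Qed.

Lemma eucl_dist_set_ltP x A e :
  (eucl_dist_set x A < e%:E)%E <-> exists2 a, A a & eucl_dist x a < e.
Proof.
split=> [/ereal_inf_ltP[_ [a Aa <-]]|[a Aa xa]]; first by exists a.
by apply/ereal_inf_ltP; exists (eucl_dist x a)%:E => //; exists a.
Qed.

(** The sup-norm counterpart of [eucl_dist_set x A < e], equivalent to it up to a factor that
    depends only on [n]. *)
Definition near_set A e x := exists2 a, A a & `|x - a| < e.

Lemma near_set_eucl A e x : (eucl_dist_set x A < e%:E)%E -> near_set A e x.
Proof.
move=> /eucl_dist_set_ltP[a Aa xa]; exists a => //.
exact: le_lt_trans (norm_le_eucl_dist _ _) xa.
Qed.

Lemma eucl_near_set A e x : near_set A (e / (Num.sqrt n%:R + 1)) x ->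
  (eucl_dist_set x A < e%:E)%E.
Proof.
move=> [a Aa xa]; apply/eucl_dist_set_ltP; exists a => //.
apply: le_lt_trans (eucl_dist_le_norm _ _) _.
(* The summand 1 keeps the factor positive when [n] is 0. *)
have n1 : 0 < Num.sqrt n%:R + 1 :> R by rewrite ltr_wpDl// sqrtr_ge0.
move: xa; rewrite ltr_pdivlMr// mulrC; apply: le_lt_trans.
by rewrite ler_wpM2r// lerDl.
Qed.

Lemma closureP A x : closure A x <-> forall e, 0 < e -> near_set A e x.
Proof.
split=> [clA e e0|xA B /nbhs_ballP[e /= e0 eB]].
  by have [a [Aa]] := clA _ (nbhsx_ballx x e e0); rewrite -ball_normE; exists a.
have [a Aa xa] := xA _ e0; exists a; split=> //; apply: eB.
by rewrite -ball_normE.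
Qed.

Lemma near_set_closure A e x : near_set (closure A) e x -> near_set A e x.
Proof.
move=> [b /closureP bA xb].
have [|a Aa ba] := bA (e - `|x - b|); first by rewrite subr_gt0.
exists a => //; rewrite -(subrKA b); apply: le_lt_trans (ler_normD _ _) _.
by rewrite -ltrBrDl.
Qed.

Lemma near_setS A e e' x : e <= e' -> near_set A e x -> near_set A e' x.
Proof. by move=> ee' [a Aa xa]; exists a => //; exact: lt_le_trans ee'. Qed.

(** Otherwise there are points of [K] and [D], ever closer to [A], that stay [e] away from the
    intersection of the closures. A cluster point of them lies in both closures, yet is within [e]
    of one of them. *)
Lemma near_setI A (D K : set 'rV[R]_n) e : compact K -> 0 < e ->
  exists2 d, 0 < d & forall x, K x -> D x -> near_set A d x ->
    near_set (closure A `&` closure D) e x.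
Proof.
move=> cK e0; apply: contrapT => nod.
have ex m : exists x, [/\ K x, D x, near_set A m.+1%:R^-1 x &
    ~ near_set (closure A `&` closure D) e x].
  apply: contrapT => nox; apply: nod; exists m.+1%:R^-1 => // x Kx Dx Ax.
  by apply: contrapT => nx; apply: nox; exists x.
pose u m := sval (cid (ex m)).
have uP m : [/\ K (u m), D (u m), near_set A m.+1%:R^-1 (u m) &
    ~ near_set (closure A `&` closure D) e (u m)] := svalP (cid (ex m)).
have [|p [Kp clup]] := cK (u @ \oo) _.
  by exists 0%N => // m _; have [] := uP m.
have frequently d N : 0 < d -> exists2 m, (N <= m)%N & `|p - u m| < d.
  move=> d0; have uN : (u @ \oo) [set u m | m in [set m | (N <= m)%N]].
    by exists N => // m /= Nm; exists m.
  have [_ [[m Nm <-]]] := clup _ _ uN (nbhsx_ballx p d d0).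
  by rewrite -ball_normE; exists m.
have clA : closure A p.
  apply/closureP => d d0; have d20 : 0 < d / 2 by rewrite divr_gt0.
  have [N _ NP] := near_infty_natSinv_lt (PosNum d20).
  have [m Nm pm] := frequently _ N d20.
  have [_ _ [a Aa ma] _] := uP m; exists a => //.
  rewrite -(subrKA (u m)); apply: le_lt_trans (ler_normD _ _) _.
  rewrite (splitr d) ltrD//; apply: (lt_trans ma); exact: NP.
have clD : closure D p.
  apply/closureP => d d0; have [m _ pm] := frequently _ 0%N d0.
  by have [_ Dm _ _] := uP m; exists (u m).
have [m _ pm] := frequently _ 0%N e0; have [_ _ _] := uP m; apply.
by exists p => //; rewrite distrC.
Qed.

End euclidean_neighbourhoods.

(** * Convex combinations and erosion of convex sets *)

Section convexity.
Variables (R : realType) (V : normedModType R) (D : set V).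
Hypothesis D_convex : convex_set (D : set (convex_lmodType V)).
Implicit Types (x y z b c : V) (p q r : R).

Lemma convex_setD p q x y : 0 <= p -> 0 <= q -> 0 < p + q -> D x -> D y ->
  D ((p + q)^-1 *: (p *: x + q *: y)).
Proof.
move=> p0 q0 pq0 Dx Dy.
have l01 : 0 <= p / (p + q) <= 1.
  by rewrite divr_ge0 ?(ltW pq0)//= ler_pdivrMr// mul1r lerDl.
have := D_convex (Itv01 (andP l01).1 (andP l01).2).
move=> /(_ x y); rewrite !inE => /(_ Dx Dy).
rewrite /conv/= -[X in X *: y]/(1 - p / (p + q)) => h; rewrite scalerDr !scalerA ![_^-1 * _]mulrC.
suff -> : q / (p + q) = 1 - p / (p + q) by [].
by rewrite -[in RHS](@divff _ (p + q)) ?gt_eqF// -mulrBl addrAC subrr add0r.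
Qed.

Definition inner r : set V := [set x | forall y, `|y| < r -> D (x + y)].

(** Translating both points by [z] translates their convex combination by [z], so eroding [D] by a
    ball keeps it convex. *)
Lemma innerD r p q x y : 0 <= p -> 0 <= q -> 0 < p + q ->
  inner r x -> inner r y -> inner r ((p + q)^-1 *: (p *: x + q *: y)).
Proof.
move=> p0 q0 pq0 Dx Dy z zr.
suff -> : (p + q)^-1 *: (p *: x + q *: y) + z =
    (p + q)^-1 *: (p *: (x + z) + q *: (y + z)).
  by apply: convex_setD => //; [exact: Dx|exact: Dy].
rewrite -[in LHS](scale1r z) -(@mulVf _ (p + q)) ?gt_eqF// -scalerA -scalerDr.
by rewrite (scalerDr p) (scalerDr q) addrACA -scalerDl.
Qed.

End convexity.

(** Replace [b] by a nearby [b'] in [D] and charge the error [p *: (b - b') + z] to [c], whose ball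
    of radius [r] counts with weight [q]. *)
Lemma convex_set_closure_inner (R : realType) n (D : set 'rV[R]_n) r p q b c z :
  convex_set (D : set (convex_lmodType 'rV[R]_n)) ->
  0 <= p -> 0 < q -> closure D b -> inner D r c -> `|z| < q * r ->
  D ((p + q)^-1 *: (p *: b + q *: c + z)).
Proof.
move=> D_convex p0 q0 Db Dc zr.
have p10 : 0 < p + 1 by rewrite ltr_wpDl.
(* The denominator is [p + 1] because [p] may vanish. *)
have [|b' Db' bb'] := (closureP D b).1 Db ((q * r - `|z|) / (p + 1)).
  by rewrite divr_gt0// subr_gt0.
have Dc' : D (c + q^-1 *: (z + p *: (b - b'))).
  apply: Dc; rewrite normrZ gtr0_norm ?invr_gt0// mulrC ltr_pdivrMr// mulrC.
  apply: le_lt_trans (ler_normD _ _) _; rewrite normrZ ger0_norm//.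
  move: bb'; rewrite ltr_pdivlMr// => bb'.
  rewrite -ltrBrDl; apply: le_lt_trans bb'.
  by rewrite mulrC ler_wpM2l// lerDl.
suff -> : p *: b + q *: c + z =
    p *: b' + q *: (c + q^-1 *: (z + p *: (b - b'))).
  by apply: (convex_setD D_convex) => //; rewrite ?ltW// ltr_wpDl.
by apply/rowP => k; rewrite !mxE; field; rewrite gt_eqF.
Qed.

(** * Recursion along a history that grows at its end *)

Section rcons_recursion.
Variables (X T : Type) (z : T) (f : seq X -> T -> X -> T).

(** The left fold carries the prefix already read, so that each step may depend on the whole
    past. *)
Definition rcons_rec (h : seq X) : T :=
  (foldl (fun a x => (rcons a.1 x, f a.1 a.2 x)) ([::], z) h).2.

Lemma rcons_rec_rcons h x : rcons_rec (rcons h x) = f h (rcons_rec h) x.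
Proof.
rewrite /rcons_rec foldl_rcons/=; set a := foldl _ _ h.
suff -> : a.1 = h by [].
by rewrite /a; elim/last_ind: h {a} => //= h y IH; rewrite foldl_rcons/= IH.
Qed.

End rcons_recursion.

(** * Finite-horizon expectations and the law of the play *)

Section expectation.
Variables (R : realType) (n : nat) (G : game R n).
Variables (sigma : strategy1 G) (tau : strategy2 G).
Implicit Types (h : history G) (f g : history G -> R) (w : play G).

(** The action of Player 2 is summed outermost: a bound valid for each [j] then holds whatever [tau]
    is. *)
Definition next_mean f h : R :=
  \sum_j tau h j * \sum_i sigma h i * f (rcons h (i, j)).

Definition mean_after t f : history G -> R := iter t next_mean f.

Lemma next_mean_ge0 f h : (forall h', 0 <= f h') -> 0 <= next_mean f h.
Proof.
move=> f0; apply: sumr_ge0 => j _; rewrite mulr_ge0 ?fdist_ge0//.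
by apply: sumr_ge0 => i _; rewrite mulr_ge0 ?fdist_ge0.
Qed.

Lemma ler_next_mean f g h : (forall x, f (rcons h x) <= g (rcons h x)) ->
  next_mean f h <= next_mean g h.
Proof.
move=> fg; apply: ler_sum => j _; rewrite ler_wpM2l ?fdist_ge0//.
by apply: ler_sum => i _; rewrite ler_wpM2l ?fdist_ge0.
Qed.

Lemma ler_mean_after f g t h : (forall h', f h' <= g h') ->
  mean_after t f h <= mean_after t g h.
Proof. by move=> fg; elim: t h => //= t IH h; exact: ler_next_mean. Qed.

Lemma submartingale_mean_after m f :
  (forall h, (size h < m)%N -> f h <= next_mean f h) ->
  forall t h, (size h + t <= m)%N -> f h <= mean_after t f h.
Proof.
move=> fS; elim=> //= t IH h; rewrite addnS => hm.
apply: (le_trans (fS h _)); first by rewrite (leq_trans _ hm)// ltnS leq_addr.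
by apply: ler_next_mean => x; apply: IH; rewrite size_rcons.
Qed.

Lemma measurable_mkseq (Q : set (history G)) t :
  measurable [set w : playM G | Q (mkseq w t)].
Proof.
rewrite (_ : mkset _ = \bigcup_(h : history G)
    [set w : playM G | Q h /\ mkseq w t = h]).
  apply: countable_bigcupT_measurable => [|h]; first exact: countableP.
  have [Qh|nQ] := pselect (Q h); last first.
    by rewrite (_ : mkset _ = set0)//; apply/seteqP; split=> // w [].
  have [[w wh]|nw] := pselect (exists w : play G, mkseq w t = h).
    rewrite (_ : mkset _ = cylinder w t); last first.
      by rewrite /cylinder wh; apply/seteqP; split=> v //= -[].
    by apply: sub_sigma_algebra; exists w, t.
  rewrite (_ : mkset _ = set0)//; apply/seteqP; split=> // w [_ wh].
  by apply: nw; exists w.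
apply/seteqP; split=> [w Qw|w [h _ [Qh wh]]]; last by rewrite /= wh.
by exists (mkseq w t).
Qed.

Lemma measurable_mkseq_all (Q : set (history G)) :
  measurable [set w : playM G | forall t, Q (mkseq w t)].
Proof.
rewrite (_ : mkset _ = \bigcap_t [set w : playM G | Q (mkseq w t)]).
  by apply: bigcapT_measurable => t; exact: measurable_mkseq.
by apply/seteqP; split=> w /= Qw t; [move=> _; exact: Qw|exact: (Qw t I)].
Qed.

Let set_next w t x : play G := fun s => if s == t then x else w s.

Let mkseq_set_next w t x : mkseq (set_next w t x) t.+1 = rcons (mkseq w t) x.
Proof.
rewrite mkseqS {2}/set_next eqxx; congr rcons; apply/eq_in_map => s.
by rewrite mem_iota add0n => /andP[_ st]; rewrite /set_next ltn_eqF.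
Qed.

Let P := play_law sigma tau.

Lemma play_law_cylinderS w t x :
  P (cylinder (set_next w t x) t.+1) =
  (fine (P (cylinder w t)) * (sigma (mkseq w t) x.1 * tau (mkseq w t) x.2))%:E.
Proof.
rewrite /P !play_lawP/= big_ord_recr/= /set_next eqxx -/(set_next w t x).
have mkE s : (s <= t)%N -> mkseq (set_next w t x) s = mkseq w s.
  move=> st; apply/eq_in_map => r; rewrite mem_iota add0n => /andP[_ rs].
  by rewrite /set_next ltn_eqF// (leq_trans rs).
rewrite mkE//; congr (_ * _)%:E; apply: eq_bigr => -[s st] _ /=.
by rewrite mkE ?(ltnW st)// ltn_eqF.
Qed.

Lemma play_law_mean_after (p : pred (history G)) t :
  P [set w | p (mkseq w t)] = (mean_after t (fun h => (p h)%:R) [::])%:E.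
Proof.
(* The Markov property, multiplied by the probability of the cylinder instead of conditioned on it,
   so that null cylinders are covered. *)
suff main : forall t w s, P (cylinder w s `&` [set v | p (mkseq v (s + t))]) =
    (fine (P (cylinder w s)) *
     mean_after t (fun h => (p h)%:R) (mkseq w s))%:E.
  have := main t (play0 G) 0%N; rewrite add0n.
  have -> : cylinder (play0 G) 0 = setT by apply/seteqP.
  by rewrite setTI probability_setT mul1r => ->.
elim=> [|{}t IH] w s.
  rewrite addn0/=; have [pw|pw] := boolP (p (mkseq w s)).
    rewrite mulr1 fineK; last by rewrite /P play_lawP.
    congr (P _); apply/seteqP; split=> v; first by case.
    by move=> wv; split=> //=; rewrite wv.
  rewrite mulr0 (_ : _ `&` _ = set0) ?measure0//.
  by apply/seteqP; split=> v //= -[wv]; rewrite wv (negbTE pw).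
rewrite (_ : _ `&` _ = \bigcup_(x in [set` enum {: act1 G * act2 G}])
    (cylinder (set_next w s x) s.+1 `&` [set v | p (mkseq v (s.+1 + t))]));
    last first.
  rewrite -addSnnS; apply/seteqP; split=> v.
    move=> [wv pv]; exists (v s); first by rewrite /= mem_enum.
    split=> //; rewrite /cylinder/= mkseq_set_next mkseqS; congr rcons.
    exact: wv.
  move=> [x _ [vx pv]]; split=> //; move: vx.
  by rewrite /cylinder/= mkseq_set_next mkseqS => /rcons_inj[].
rewrite measure_fin_bigcup//=; last first.
- move=> x _; apply: measurableI; last exact: (measurable_mkseq p).
  by apply: sub_sigma_algebra; exists (set_next w s x), s.+1.
- move=> x y _ _ [v [[+ _] [+ _]]]; rewrite /cylinder/= !mkseq_set_next.
  by move=> -> /rcons_inj[].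
rewrite -fsbig_seq ?enum_uniq// big_enum/=.
under eq_bigr => x _ do rewrite IH play_law_cylinderS mkseq_set_next.
rewrite sumEFin; congr _%:E; rewrite /next_mean mulr_sumr.
pose F i j : R := fine (P (cylinder w s)) *
  (sigma (mkseq w s) i * tau (mkseq w s) j) *
  mean_after t (fun h => (p h)%:R) (rcons (mkseq w s) (i, j)).
rewrite (eq_bigr (fun x => F x.1 x.2)); last by move=> [i j].
rewrite -(pair_bigA _ F)/= exchange_big/=.
apply: eq_bigr => j _; rewrite !mulr_sumr; apply: eq_bigr => i _.
by rewrite /F; ring.
Qed.

(** Prefix-closedness makes the events decrease with [t], and the measure is continuous from
    above. *)
Lemma play_law_prefix_closed (p : pred (history G)) c :
  (forall h x, p (rcons h x) -> p h) ->
  (forall t, (c%:E <= P [set w | p (mkseq w t)])%E) ->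
  (c%:E <= P [set w | forall t, p (mkseq w t)])%E.
Proof.
move=> p_rcons cP; pose F t : set (playM G) := [set w | p (mkseq w t)].
have mF t : measurable (F t) by exact: (measurable_mkseq p).
rewrite (_ : mkset _ = \bigcap_t F t); last first.
  by apply/seteqP; split=> w /= pw t; [move=> _; exact: pw|exact: (pw t I)].
have cvF : (P \o F) t @[t --> \oo] --> P (\bigcap_t F t).
  apply: nonincreasing_cvg_mu => //.
  - by apply: (le_lt_trans (probability_le1 P (mF _))); exact: ltry.
  - exact: bigcapT_measurable.
  move=> s t /subnKC <-; apply/subsetPset => w; rewrite /F /=.
  elim: (t - s)%N => [|k IH]; first by rewrite addn0.
  by rewrite addnS mkseqS => /p_rcons.
rewrite -(cvg_lim _ cvF)//; apply: lime_ge; first exact: (cvgP _ cvF).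
by apply: nearW => t; exact: cP.
Qed.

End expectation.

(** * Totals and means of payoffs along a history *)

Section histories.
Variables (R : realType) (n : nat) (G : game R n).
Implicit Types (h q : history G) (x : act1 G * act2 G) (w : play G).
Implicit Types b : 'rV[R]_n.

Definition total h : 'rV[R]_n := \sum_(x <- h) payoff x.1 x.2.

Definition mean h : 'rV[R]_n := (size h)%:R^-1 *: total h.

Lemma avg_payoffE t w : avg_payoff t w = mean (mkseq w t).
Proof.
rewrite /avg_payoff /mean /total size_mkseq big_map.
rewrite -(big_mkord xpredT (fun s => payoff (w s).1 (w s).2)).
by rewrite /index_iota subn0.
Qed.

Lemma total_rcons h x : total (rcons h x) = total h + payoff x.1 x.2.
Proof. by rewrite /total big_rcons/= addrC. Qed.

Lemma mean_seq1 x : mean [:: x] = payoff x.1 x.2.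
Proof. by rewrite /mean /total big_seq1 invr1 scale1r. Qed.

Lemma scale_mean h : (size h)%:R *: mean h = total h.
Proof.
case: h => [|x h]; first by rewrite /total big_nil scale0r.
by rewrite /mean scalerA divff ?scale1r// pnatr_eq0.
Qed.

Lemma norm_payoffB (x y : act1 G * act2 G) :
  `|payoff x.1 x.2 - payoff y.1 y.2| <= 1.
Proof.
apply: norm_rV_le => // k; rewrite !mxE ler_norml.
have /andP[? ?] := payoff01 x.1 x.2 k; have /andP[? ?] := payoff01 y.1 y.2 k.
by apply/andP; split; lra.
Qed.

Lemma norm_totalB h b : (forall x, `|payoff x.1 x.2 - b| <= 1) ->
  `|total h - (size h)%:R *: b| <= (size h)%:R.
Proof.
move=> b1; elim/last_ind: h => [|h x IH].
  by rewrite /total big_nil scale0r subr0 normr0.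
rewrite total_rcons size_rcons -natr1 scalerDl scale1r opprD addrACA.
by apply: le_trans (ler_normD _ _) _; rewrite lerD.
Qed.

Lemma norm_payoff_mean h x : h != [::] -> `|payoff x.1 x.2 - mean h| <= 1.
Proof.
move=> h0; have sh : 0 < (size h)%:R :> R by rewrite ltr0n lt0n size_eq0.
have : `|total h - (size h)%:R *: payoff x.1 x.2| <= (size h)%:R.
  by apply: norm_totalB => y; exact: norm_payoffB.
rewrite -scale_mean -scalerBr normrZ gtr0_norm// distrC.
by rewrite -[leRHS]mulr1 ler_pM2l.
Qed.

Lemma compact_payoff_cube : compact [set b : 'rV[R]_n | `|b| <= 1].
Proof.
apply: bounded_closed_compact.
  by exists 1; split=> // y y1 b /= /le_trans; apply; exact: ltW.
rewrite (_ : mkset _ = closed_ball 0 1)//.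
  exact: closed_ball_closed.
by rewrite closed_ballE//; apply/seteqP; split=> b;
  rewrite /closed_ball_ /= sub0r normrN.
Qed.

Lemma norm_mean h : `|mean h| <= 1.
Proof.
rewrite /mean; case: h => [|x h]; first by rewrite invr0 scale0r normr0.
rewrite normrZ gtr0_norm ?invr_gt0 ?ltr0n// mulrC ler_pdivrMr ?ltr0n// mul1r.
have := @norm_totalB (x :: h) 0; rewrite scaler0 subr0; apply => y.
rewrite subr0; apply: norm_rV_le => // k.
by have /andP[u0 u1] := payoff01 y.1 y.2 k; rewrite ger0_norm.
Qed.

End histories.

(** * Safe stages, and a bound on the number of unsafe ones *)

Section safe_play.
Variables (R : realType) (n : nat) (G : game R n) (D : set 'rV[R]_n).
Hypothesis D_convex : convex_set (D : set (convex_lmodType 'rV[R]_n)).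
Variable s : act1 G.
Implicit Types (h q : history G) (x : act1 G * act2 G) (b : 'rV[R]_n).

Definition safe h : bool := `[< forall x, D (mean (rcons h x)) >].

(* The sub-history of the safe stages. *)
Definition active : history G -> history G :=
  rcons_rec [::] (fun h q x => if safe h then rcons q x else q).

(* The histories where s was played at all unsafe stages. *)
Definition obeys : pred (history G) :=
  rcons_rec true (fun h o x => o && (safe h || (x.1 == s))).

Lemma active_rcons h x :
  active (rcons h x) = if safe h then rcons (active h) x else active h.
Proof. exact: rcons_rec_rcons. Qed.

Lemma obeys_rcons h x : obeys (rcons h x) = obeys h && (safe h || (x.1 == s)).
Proof. exact: rcons_rec_rcons. Qed.

Lemma size_active h : (size (active h) <= size h)%N.
Proof.
elim/last_ind: h => // h x IH; rewrite active_rcons size_rcons.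
by case: ifP => _; rewrite ?size_rcons// leqW.
Qed.

(** A safe stage leads into [D] by definition; an unsafe one averages the previous mean with a
    payoff of [s], both in [D]. *)
Lemma obeys_mean h : (forall j, D (payoff s j)) -> obeys h -> h != [::] ->
  D (mean h).
Proof.
move=> Ds; elim/last_ind: h => // h x IH.
rewrite obeys_rcons => /andP[oh /orP[/asboolP//|/eqP xs]] _.
(* The empty history has mean 0 by convention, which may lie outside [D], so the first stage is
   treated apart. *)
have [->|h0] := eqVneq h [::]; first by rewrite mean_seq1 xs.
rewrite /mean total_rcons size_rcons -scale_mean -natr1 xs.
rewrite -[payoff _ _ in X in D X]scale1r.
by apply: convex_setD => //; exact: IH.
Qed.

(** The number of unsafe stages; [filler_total] is the sum of the payoffs obtained there. *)
Definition fillers h : nat := size h - size (active h).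
Definition filler_total h : 'rV[R]_n := total h - total (active h).

Lemma size_fillers h : (size h = size (active h) + fillers h)%N.
Proof. by rewrite /fillers subnKC// size_active. Qed.

Lemma fillers_rcons h x : fillers (rcons h x) = (fillers h + ~~ safe h)%N.
Proof.
rewrite /fillers active_rcons size_rcons; case: ifP => _.
  by rewrite size_rcons subSS addn0.
by rewrite addn1 subSn// size_active.
Qed.

Lemma filler_total_rcons h x : filler_total (rcons h x) =
  if safe h then filler_total h else filler_total h + payoff x.1 x.2.
Proof.
rewrite /filler_total active_rcons total_rcons; case: ifP => _.
  by rewrite total_rcons opprD addrACA subrr addr0.
by rewrite addrAC.
Qed.

Lemma norm_filler_totalB h b : (forall x, `|payoff x.1 x.2 - b| <= 1) ->
  `|filler_total h - (fillers h)%:R *: b| <= (fillers h)%:R.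
Proof.
move=> b1; elim/last_ind: h => [|h x IH].
  by rewrite [filler_total _]subrr scale0r subr0 normr0.
rewrite filler_total_rcons fillers_rcons; case: (safe h); first by rewrite addn0.
rewrite addn1 -natr1 scalerDl scale1r opprD addrACA.
by apply: le_trans (ler_normD _ _) _; rewrite lerD.
Qed.

Variable r : R.
Hypothesis Ds : forall j, inner D r (payoff s j).

(** Only [s] is played at unsafe stages, so their mean payoff is a convex combination of points of
    the convex set [inner D r]. *)
Lemma inner_fillers h : obeys h -> (0 < fillers h)%N ->
  inner D r ((fillers h)%:R^-1 *: filler_total h).
Proof.
elim/last_ind: h => // h x IH; rewrite obeys_rcons => /andP[oh].
rewrite fillers_rcons filler_total_rcons; case: (safe h) => /=.
  by move=> _; rewrite addn0; exact: IH.
move=> /eqP xs _; rewrite addn1 xs.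
have [f0|f0] := posnP (fillers h).
  have -> : filler_total h = 0.
    apply/eqP; rewrite -normr_le0.
    have := @norm_filler_totalB h (payoff x.1 x.2) (fun y => norm_payoffB y x).
    by rewrite f0 scale0r subr0.
  by rewrite f0 add0r invr1 scale1r.
rewrite -natr1 -[payoff _ _]scale1r.
rewrite -[filler_total h](@scalerKV _ _ (fillers h)%:R) ?pnatr_eq0 -?lt0n//.
by apply: innerD => //; exact: IH.
Qed.

Variables (B : set 'rV[R]_n) (e : R) (T : nat).
Hypotheses (BD : B `<=` closure D) (e0 : 0 < e) (T0 : (0 < T)%N) (r0 : 0 < r).

(** All long prefixes are constrained, which makes the predicate prefix-closed. *)
Definition near_from : pred (history G) := fun q =>
  `[< forall t, (T <= t <= size q)%N -> near_set B e (mean (take t q)) >].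

Lemma near_from_rcons q x : near_from (rcons q x) -> near_from q.
Proof.
move=> /asboolP Bq; apply/asboolP => t /andP[Tt tq].
have := Bq t; rewrite Tt size_rcons leqW// => /(_ isT).
by rewrite -cats1 takel_cat.
Qed.

Lemma near_fromP q : near_from q -> (T <= size q)%N -> near_set B e (mean q).
Proof. by move=> /asboolP/(_ (size q)) + Tq; rewrite Tq leqnn take_size; exact. Qed.

(** By contraposition: the room of the fillers, [r] each, absorbs the error of the sub-history and
    of any next payoff, so the next mean is in [D]. *)
Lemma unsafe_fillers h : obeys h -> near_from (active h) -> ~~ safe h ->
  (fillers h)%:R * r <= T%:R + 1 + (size h).+1%:R * e.
Proof.
move=> oh gh; apply: contraNT; rewrite -ltNge => hr; apply/asboolP => x.
set q := active h in gh *; set M := fillers h in hr *.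
have M0 : (0 < M)%N.
  rewrite lt0n; apply/eqP => M0; move: hr; rewrite M0 mul0r ltNge.
  by rewrite !addr_ge0// ?ler0n// mulr_ge0// ltW.
rewrite {1}/mean size_rcons total_rcons.
(* The next payoff is counted with the sub-history, whatever the status of its stage. *)
have sE : (size h).+1%:R = (size q).+1%:R + M%:R :> R.
  by rewrite -natrD addSn -size_fillers.
suff [b Db zb] : exists2 b, closure D b &
    `|total q + payoff x.1 x.2 - (size q).+1%:R *: b| < M%:R * r.
  rewrite sE (_ : total h + _ = (size q).+1%:R *: b +
      M%:R *: (M%:R^-1 *: filler_total h) +
      (total q + payoff x.1 x.2 - (size q).+1%:R *: b)).
    apply: (convex_set_closure_inner D_convex _ _ Db _ zb) => //.
      by rewrite ltr0n.
    exact: inner_fillers.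
  rewrite scalerA divff ?pnatr_eq0 -?lt0n// scale1r /filler_total -/q.
  by apply/rowP => k; rewrite !mxE; ring.
have [Tq|qT] := leqP T (size q).
  have [b Bb qb] := near_fromP gh Tq; exists b; first exact: BD.
  have q0 : q != [::] by rewrite -size_eq0 -lt0n (leq_trans T0).
  have := norm_payoff_mean x q0 => xq.
  rewrite -scale_mean -natr1 scalerDl scale1r opprD addrACA -scalerBr.
  apply: le_lt_trans hr; apply: le_trans (ler_normD _ _) _.
  rewrite normrZ normr_nat.
  have : `|payoff x.1 x.2 - b| <= 1 + e.
    rewrite -(subrKA (mean q)); apply: le_trans (ler_normD _ _) _.
    by rewrite lerD// ltW.
  have : (size q)%:R * `|mean q - b| <= (size q)%:R * e.
    by rewrite ler_wpM2l// ltW.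
  have : (size q)%:R * e + e <= (size h).+1%:R * e.
    rewrite -[in X in _ + X](mul1r e) -mulrDl ler_pM2r// natr1 ler_nat.
    by rewrite ltnS size_active.
  have : 0 <= T%:R :> R by [].
  lra.
(* A sub-history shorter than [T] need not be near [B]. Any payoff of [s] serves as [b]: at most [T]
   payoffs are involved, each within 1 of it. *)
exists (payoff s x.2).
  apply: subset_closure; rewrite -[payoff _ _]addr0; apply: Ds.
  by rewrite normr0.
have := @norm_totalB _ _ _ (rcons q x) (payoff s x.2)
  (fun y => norm_payoffB y (s, x.2)).
rewrite total_rcons size_rcons => /le_lt_trans; apply; apply: le_lt_trans hr.
have : (size q).+1%:R <= T%:R :> R by rewrite ler_nat.
have : 0 <= (size h).+1%:R * e by rewrite mulr_ge0// ltW.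
lra.
Qed.

(** The count grows only at an unsafe stage, where [unsafe_fillers] bounds the previous count; the
    extra [r] pays for that stage. *)
Lemma fillers_le h : obeys h -> near_from (active h) ->
  (fillers h)%:R * r <= r + T%:R + 1 + (size h)%:R * e.
Proof.
elim/last_ind: h => [|h x IH].
  by rewrite /fillers mul0r mul0r addr0 !addr_ge0// ltW.
rewrite obeys_rcons => /andP[oh _] gh.
have {}gh : near_from (active h).
  by move: gh; rewrite active_rcons; case: ifP => // _ /near_from_rcons.
rewrite fillers_rcons size_rcons; have [sh|sh] := boolP (safe h).
  rewrite addn0; apply: le_trans (IH oh gh) _.
  by rewrite lerD2l ler_pM2r// ler_nat.
by have := unsafe_fillers oh gh sh; rewrite addn1 -natr1 mulrDl mul1r; lra.
Qed.

(** The fillers are a fraction at most [2 * e / r] of the stages, and each of their payoffs is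
    within 1 of the mean of the sub-history. *)
Lemma near_mean h : e <= r / 4 -> obeys h -> near_from (active h) ->
  r + T%:R + 1 <= (size h)%:R * e -> (2 * T <= size h)%N ->
  near_set B (e + 2 * e / r) (mean h).
Proof.
move=> er oh gh he hT; set t := size h in he hT *; set q := active h in gh *.
have t0 : 0 < t%:R :> R by rewrite ltr0n (leq_trans _ hT)// muln_gt0.
have Mt : (fillers h)%:R * r <= 2 * (t%:R * e).
  by have := fillers_le oh gh; rewrite -/t; lra.
have tE : t%:R = (size q)%:R + (fillers h)%:R :> R by rewrite -natrD -size_fillers.
(* As [e <= r / 4], at most half of the stages are fillers, which leaves at least [T] safe ones. *)
have Tq : (T <= size q)%N.
  rewrite -(ler_nat R); move: hT; rewrite -(ler_nat R) natrM => hT.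
  have : (fillers h)%:R <= t%:R / 2 :> R.
    rewrite -(ler_pM2r r0); apply: le_trans Mt _.
    have : t%:R * e <= t%:R * (r / 4) by rewrite ler_pM2l.
    by lra.
  by lra.
have [b Bb qb] := near_fromP gh Tq; exists b => //.
have q0 : q != [::] by rewrite -size_eq0 -lt0n (leq_trans T0).
rewrite -(subrKA (mean q)); apply: le_lt_trans (ler_normD _ _) _.
rewrite addrC ltr_leD//.
have := @norm_filler_totalB h (mean q) (fun y => norm_payoff_mean y q0).
have -> : filler_total h - (fillers h)%:R *: mean q = t%:R *: (mean h - mean q).
  rewrite scalerBr scale_mean tE scalerDl scale_mean /filler_total -/q.
  by rewrite opprD addrA.
rewrite normrZ normr_nat => hq.
rewrite ler_pdivlMr// -(ler_pM2l t0).
apply: le_trans (_ : (fillers h)%:R * r <= _); first by rewrite mulrA ler_pM2r.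
by rewrite mulrCA.
Qed.

End safe_play.

(** * Best replies of Player 2 on a finite horizon *)

Section finite_horizon_value.
Variables (R : realType) (n : nat) (G : game R n) (sigma : strategy1 G).
Variable p : pred (history G).
Hypothesis p_rcons : forall h x, p (rcons h x) -> p h.
Implicit Types (h : history G) (tau : strategy2 G).

Lemma dirac_ge0 (X : finType) (x y : X) : 0 <= (y == x)%:R :> R.
Proof. by rewrite ler0n. Qed.

Lemma dirac_sum1 (X : finType) (x : X) : \sum_y (y == x)%:R = 1 :> R.
Proof. by rewrite (bigD1 x)//= eqxx big1 ?addr0// => y /negbTE ->. Qed.

Definition fdirac (X : finType) (x : X) : fdist R X :=
  FDist (dirac_ge0 x) (dirac_sum1 x).

Lemma sum_fdirac (X : finType) (x : X) (f : X -> R) :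
  \sum_y fdirac x y * f y = f x.
Proof.
rewrite (bigD1 x)//= eqxx mul1r big1 ?addr0// => y /negbTE.
by rewrite /fdirac/= => ->; rewrite mul0r.
Qed.

Lemma le_sum_fdist (X : finType) (d : fdist R X) (c : R) (f : X -> R) :
  (forall x, c <= f x) -> c <= \sum_x d x * f x.
Proof.
move=> cf; rewrite -[c]mul1r -(fdist_sum1 d) mulr_suml.
by apply: ler_sum => x _; rewrite ler_wpM2l// fdist_ge0.
Qed.

Lemma ge_sum_fdist (X : finType) (d : fdist R X) (c : R) (f : X -> R) :
  (forall x, f x <= c) -> \sum_x d x * f x <= c.
Proof.
move=> cf; rewrite -[c]mul1r -(fdist_sum1 d) mulr_suml.
by apply: ler_sum => x _; rewrite ler_wpM2l// fdist_ge0.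
Qed.

Let reply (f : history G -> R) h : act2 G :=
  [arg min_(j < (play0 G 0).2) \sum_i sigma h i * f (rcons h (i, j))]%O.

(* The value, k stages before the end and after the history [h], of the
   game in which Player 1 follows [sigma] and Player 2 tries to violate [p]. *)
Fixpoint value k h : R :=
  if k is k'.+1 then
    \sum_i sigma h i * value k' (rcons h (i, reply (value k') h))
  else (p h)%:R.

Lemma value_le k h j :
  value k.+1 h <= \sum_i sigma h i * value k (rcons h (i, j)).
Proof. by rewrite /= /reply; case: arg_minP => //= i _; exact. Qed.

Lemma value_ge0 k h : 0 <= value k h.
Proof.
by elim: k h => [|k IH] h /=; [rewrite ler0n|exact: le_sum_fdist].
Qed.

(** A violation of [p] is never repaired, because [p] is prefix-closed; the value is then 0. *)
Lemma value_le_pred k h : value k h <= (p h)%:R.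
Proof.
elim: k h => //= k IH h; apply: ge_sum_fdist => i; apply: le_trans (IH _) _.
by rewrite ler_nat; case: (p _) (@p_rcons h (i, reply (value k) h)) => // ->.
Qed.

Lemma value_play_law m : exists tau,
  play_law sigma tau [set w | p (mkseq w m)] = (value m [::])%:E.
Proof.
(* After [h], [m - size h] stages remain; the reply minimises the value one stage later, hence the
   predecessor. *)
pose tau : strategy2 G := fun h => fdirac (reply (value (m - size h).-1) h).
exists tau; rewrite play_law_mean_after; congr _%:E.
suff main k h : (k + size h = m)%N ->
    mean_after sigma tau k (fun h => (p h)%:R) h = value k h.
  by apply: main; rewrite addn0.
elim: k h => // k IH h km; rewrite /mean_after iterS -/(mean_after _ _ _ _).
rewrite /next_mean sum_fdirac/= -km addSn subSn ?leq_addl// addnK/=.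
apply: eq_bigr => i _; rewrite IH// size_rcons addnS.
by rewrite -km addSn.
Qed.

End finite_horizon_value.

(** * Law of the sub-history of safe stages *)

Section sub_history.
Variables (R : realType) (n : nat) (G : game R n) (D : set 'rV[R]_n).
Variables (s : act1 G) (sigma : strategy1 G).
Implicit Types (h : history G) (tau : strategy2 G).

Definition safe_strategy : strategy1 G := fun h =>
  if safe D h then sigma (active D h) else fdirac R s.

(* Interleaving [sigma] with stages where it is suspended cannot help Player 2
   to violate [p]: the value of the current sub-history is a submartingale. *)
Lemma safe_strategy_active (p : pred (history G)) c :
  (forall h x, p (rcons h x) -> p h) ->
  (forall tau m, (c%:E <= play_law sigma tau [set w | p (mkseq w m)])%E) ->
  forall tau, (c%:E <= play_law safe_strategy tau
    [set w | forall t, obeys D s (mkseq w t) && p (active D (mkseq w t))])%E.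
Proof.
move=> p_rcons cp tau.
pose p' h := obeys D s h && p (active D h).
apply: (@play_law_prefix_closed _ _ _ _ _ p') => [h x|m]; rewrite /p'.
  rewrite obeys_rcons active_rcons => /andP[/andP[-> _]] /=.
  by case: ifP => // _ /p_rcons.
have [tau' tau'm] := value_play_law sigma p m.
apply: (le_trans (cp tau' m)); rewrite tau'm (play_law_mean_after _ _ p') lee_fin.
(* The remaining horizon is counted in safe stages, so the value is frozen while [s] is played. *)
pose f h := (obeys D s h)%:R * value sigma p (m - size (active D h)) (active D h).
have -> : value sigma p m [::] = f [::] by rewrite /f/= mul1r subn0.
(* After [m] stages the sub-history may be shorter than [m]; its value is still at most the
   indicator of [p]. *)
apply: le_trans (_ : mean_after safe_strategy tau m f [::] <= _); last first.
  apply: ler_mean_after => h; rewrite /f /p' -mulnb natrM ler_wpM2l//.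
  exact: value_le_pred.
apply: (@submartingale_mean_after _ _ _ _ _ m) => // h hm.
rewrite {1}/f; have [oh|_] := boolP (obeys D s h); last first.
  by rewrite mul0r next_mean_ge0// => h'; rewrite mulr_ge0// value_ge0.
have am : (size (active D h) < m)%N := leq_ltn_trans (size_active D h) hm.
rewrite mul1r /next_mean /safe_strategy; apply: le_sum_fdist => j.
have [sh|sh] := boolP (safe D h); last first.
  by rewrite sum_fdirac /f obeys_rcons oh eqxx orbT mul1r active_rcons (negbTE sh).
(* At a safe stage Player 1 follows [sigma], and no [j] does better for Player 2 than the best
   reply. *)
rewrite -(subnSK am); apply: le_trans (value_le _ _ _ _ j) _.
apply: ler_sum => i _; rewrite ler_wpM2l ?fdist_ge0//.
by rewrite /f obeys_rcons oh sh mul1r active_rcons sh size_rcons.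
Qed.

End sub_history.

(** * Measurability and almost sure events *)

Section events.
Variables (R : realType) (n : nat) (G : game R n).
Implicit Types (A D : set 'rV[R]_n) (e : R) (T : nat).

Lemma measurable_avg_payoff (Q : nat -> set 'rV[R]_n) :
  measurable [set w : playM G | forall t, Q t (avg_payoff t w)].
Proof.
rewrite (_ : mkset _ =
    [set w : playM G | forall t, Q (size (mkseq w t)) (mean (mkseq w t))]).
  exact: (measurable_mkseq_all (fun h => Q (size h) (mean h))).
apply/seteqP; split=> w /= Qw t; last by have := Qw t; rewrite size_mkseq avg_payoffE.
by rewrite size_mkseq -avg_payoffE; exact: Qw.
Qed.

Lemma measurable_eventually_near A e T : measurable (@eventually_near R n G A e T).
Proof.
exact: (measurable_avg_payoff (fun t a =>
  (1 <= t)%N -> (T <= t)%N -> (eucl_dist_set a A < e%:E)%E)).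
Qed.

Lemma measurable_always_in D : measurable (@always_in R n G D).
Proof. exact: (measurable_avg_payoff (fun t a => (1 <= t)%N -> D a)). Qed.

End events.

Lemma probability_setI1 d (T : measurableType d) (R : realType)
    (P : probability T R) (A B : set T) :
  measurable A -> measurable B -> P B = 1%E -> P (A `&` B) = P A.
Proof.
move=> mA mB PB; apply/eqP; rewrite eq_le le_measure ?inE//=; last first.
  exact: measurableI.
have nB : P (~` B) = 0%E by rewrite probability_setC// PB subee.
rewrite -[P (_ `&` _)]adde0 -nB.
apply: le_trans (measureU2 _ _ _) => //; [|exact: measurableI|exact: measurableC].
rewrite le_measure ?inE//; last first.
  by move=> x Ax; have [Bx|Bx] := pselect (B x); [left|right].
apply: measurableU; [exact: measurableI|exact: measurableC].
Qed.

(** * Necessity of the two conditions *)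

Section necessity.
Variables (R : realType) (n : nat) (G : game R n) (A D : set 'rV[R]_n).

Lemma approachable_remaining_closure : approachable_remaining_in G A D ->
  approachable G (closure A `&` closure D).
Proof.
move=> [sigma sigmaP]; exists sigma => e e0.
have e10 : 0 < e / (Num.sqrt n%:R + 1) by rewrite divr_gt0// ltr_wpDl// sqrtr_ge0.
have [d d0 dP] := near_setI A D (@compact_payoff_cube R n) e10.
(* [d] controls the distance to [A], [e] the probability. *)
have [|T TP] := sigmaP (Num.min d e); first by rewrite lt_min d0.
exists T => tau; have [near_A in_D] := TP tau.
apply: lt_le_trans (_ : (play_law sigma tau
    (eventually_near A (Num.min d e) T `&` always_in D) <= _)%E).
  rewrite probability_setI1//; last 2 first.
  - exact: measurable_eventually_near.
  - exact: measurable_always_in.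
  apply: le_lt_trans near_A; rewrite lee_fin lerD2l lerN2.
  by rewrite ge_min lexx orbT.
apply: le_measure; rewrite ?inE.
- apply: measurableI; first exact: measurable_eventually_near.
  exact: measurable_always_in.
- exact: measurable_eventually_near.
move=> w [wA wD] t t1 Tt; apply/eucl_near_set/dP.
- by rewrite /= avg_payoffE norm_mean.
- exact: wD.
- apply/near_set_eucl/(lt_le_trans (wA t t1 Tt)).
  by rewrite lee_fin ge_min lexx.
Qed.

(** Take [s] in the support of the first move. If Player 2 always plays [j], the pair [(s, j)] opens
    the play with positive probability, so some such play stays in [D], and its first mean is
    [payoff s j]. *)
Lemma approachable_remaining_action : approachable_remaining_in G A D ->
  exists s : act1 G, forall j : act2 G, D (payoff s j).
Proof.
move=> [sigma sigmaP]; have [T TP] := sigmaP 1 ltr01.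
have [s s0] : exists s, 0 < sigma [::] s.
  apply: contrapT => ns; have := fdist_sum1 (sigma [::]).
  rewrite big1 => [/eqP|i _]; first by rewrite eq_sym oner_eq0.
  apply/eqP; rewrite eq_le fdist_ge0 andbT leNgt.
  by apply/negP => ?; apply: ns; exists i.
exists s => j; pose tau : strategy2 G := fun=> fdirac R j.
have [_ D1] := TP tau; pose w : play G := fun=> (s, j).
have mC : measurable (cylinder w 1 : set (playM G)).
  by apply: sub_sigma_algebra; exists w, 1%N.
have := probability_setI1 mC (@measurable_always_in _ _ G D) D1.
rewrite play_lawP big_ord1/= eqxx mulr1 => PC.
have [v [vw vD]] : cylinder w 1 `&` always_in D !=set0.
  apply/set0P/eqP => C0; move: PC; rewrite C0 measure0 => -[] /eqP.
  by rewrite lt_eqF.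
have := vD 1%N isT; rewrite avg_payoffE vw /= mean_seq1.
exact.
Qed.

End necessity.

(** * Sufficiency of the two conditions *)

Lemma inner_finite (R : realType) n (D : set 'rV[R]_n) (J : finType)
    (u : J -> 'rV[R]_n) :
  open D -> (forall j, D (u j)) -> exists2 r, 0 < r & forall j, inner D r (u j).
Proof.
move=> D_open Du.
have rP j : exists2 r, 0 < r & inner D r (u j).
  have /nbhs_ballP[r /= r0 rD] := open_nbhs_nbhs (conj D_open (Du j)).
  exists r => // y yr; apply: rD; rewrite -ball_normE /=.
  by rewrite opprD addrA subrr sub0r normrN.
pose r j := sval (cid2 (rP j)).
have r0 j : 0 < r j by rewrite /r; case: cid2.
have rD j : inner D (r j) (u j) by rewrite /r; case: cid2.
exists (\big[Num.min/1]_j r j).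
  by apply: lt_bigmin => // j _; exact: r0.
move=> j y yr; apply: rD; apply: lt_le_trans yr _; exact: bigmin_le.
Qed.

Section sufficiency.
Variables (R : realType) (n : nat) (G : game R n) (A D : set 'rV[R]_n).
Hypotheses (D_open : open D).
Hypothesis D_convex : convex_set (D : set (convex_lmodType 'rV[R]_n)).

(** The strategy is fixed before [e]; the radius and the tolerances enter only its analysis. *)
Lemma approachable_closure_remaining (s : act1 G) :
  (forall j, D (payoff s j)) -> approachable G (closure A `&` closure D) ->
  approachable_remaining_in G A D.
Proof.
move=> Ds [sigma sigmaP]; exists (safe_strategy D s sigma) => e e0.
have [r r0 Dr] := inner_finite D_open Ds.
set B := closure A `&` closure D in sigmaP.
have BD : B `<=` closure D by move=> x [].
pose e1 := e / (Num.sqrt n%:R + 1).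
have e10 : 0 < e1 by rewrite divr_gt0// ltr_wpDl// sqrtr_ge0.
(* The three bounds serve, in order, the strict inequality on probabilities, the hypothesis of
   [near_mean], and a final distance of at most [e1]. *)
pose e2 := Num.min (Num.min (e / 2) (r / 4)) (e1 / (1 + 2 / r)).
have r21 : 0 < 1 + 2 / r by rewrite addr_gt0// divr_gt0.
have e20 : 0 < e2 by rewrite !lt_min !divr_gt0.
have [T TP] := sigmaP e2 e20.
(* The successor makes the threshold positive. *)
pose T1 := T.+1.
have e2e : e2 <= e / 2 by rewrite !ge_min lexx.
have e2r : e2 <= r / 4 by rewrite !ge_min lexx orbT.
have e2e1 : e2 + 2 * e2 / r <= e1.
  have : e2 <= e1 / (1 + 2 / r) by rewrite !ge_min lexx !orbT.
  rewrite ler_pdivlMr//; congr (_ <= _); ring.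
pose p : pred (history G) := near_from B e2 T1.
have cp tau m : ((1 - e2)%:E <= play_law sigma tau [set w | p (mkseq w m)])%E.
  apply: (le_trans (ltW (TP tau))); apply: le_measure; rewrite ?inE.
  - exact: measurable_eventually_near.
  - exact: (measurable_mkseq p).
  move=> w wT; apply/asboolP => t; rewrite size_mkseq => /andP[Tt tm].
  have -> : take t (mkseq w m) = mkseq w t.
    by rewrite /mkseq -map_take take_iota (minn_idPl tm).
  rewrite -avg_payoffE; apply/near_set_eucl/wT; last exact: ltnW.
  exact: leq_trans Tt.
pose K := Num.bound ((r + T1%:R + 1) / e2); pose T2 := maxn K (2 * T1).
have KP : (r + T1%:R + 1) / e2 <= K%:R.
  by apply/ltW/archi_boundP; rewrite divr_ge0 ?addr_ge0 ?(ltW r0) ?(ltW e20).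
have w0 (w : play G) t : (0 < t)%N -> mkseq w t != [::].
  by rewrite -size_eq0 size_mkseq lt0n.
exists T2 => tau; split.
  have lt12 : ((1 - e)%:E < (1 - e2)%:E)%E.
    rewrite lte_fin ltrD2l ltrN2; apply: le_lt_trans e2e _.
    by rewrite ltr_pdivrMr// ltr_pMr// ltr1n.
  apply: (lt_le_trans lt12).
  apply: le_trans (safe_strategy_active D s (@near_from_rcons _ _ _ _ _ _) cp tau) _.
  apply: le_measure; rewrite ?inE.
  - exact: (measurable_mkseq_all (fun h => obeys D s h && p (active D h))).
  - exact: measurable_eventually_near.
  move=> w wP t t1 T2t; have /andP[ot pt] := wP t.
  apply/eucl_near_set/near_set_closure.
  have [b [clAb _] tb] : near_set B e1 (avg_payoff t w).
    apply: near_setS e2e1 _; rewrite avg_payoffE.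
    apply: (near_mean D_convex Dr BD e20 _ r0 e2r ot pt) => //; rewrite size_mkseq.
      rewrite -ler_pdivrMr//; apply: le_trans KP _.
      by rewrite ler_nat (leq_trans _ T2t)// leq_maxl.
    by rewrite (leq_trans _ T2t)// leq_maxr.
  by exists b.
apply/eqP; rewrite eq_le probability_le1/=; last exact: measurable_always_in.
(* With the trivial predicate, only obedience remains, with probability 1. *)
apply: le_trans (@safe_strategy_active _ _ _ D s sigma xpredT 1 _ _ tau) _ => //.
  move=> tau' m; rewrite (_ : mkset _ = setT) ?probability_setT//.
  exact/seteqP.
apply: le_measure; rewrite ?inE.
- exact: (measurable_mkseq_all (fun h => obeys D s h && true)).
- exact: measurable_always_in.
move=> w wP t t1; rewrite avg_payoffE; have /andP[ot _] := wP t.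
exact: (obeys_mean D_convex Ds ot (w0 _ _ t1)).
Qed.

End sufficiency.

Theorem theorem3 (R : realType) (n : nat) (G : game R n)
    (A D : set 'rV[R]_n)
    (D_open : open D) (D_convex : convex_set (D : set (convex_lmodType 'rV[R]_n))) :
  approachable_remaining_in G A D <->
  approachable G (closure A `&` closure D) /\
  (exists s : act1 G, forall j : act2 G, D (payoff s j)).
Proof.
split=> [AD|[B_appr [s Ds]]]; last first.
  exact: (approachable_closure_remaining D_open D_convex Ds).
split; first exact: approachable_remaining_closure.
exact: approachable_remaining_action AD.
Qed.
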